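(* Let $L$ be a set of $n$ lines in the real projective plane in general position (no three of the lines pass through a common point), and let $\mathcal{A}(L)$ be the arrangement of vertices, edges and faces they determine. Then $C(L)\le 5$; that is, there exists a vertex $v$ of $\mathcal{A}(L)$ such that, if $\ell_1^v,\ell_2^v$ are the two lines of $L$ passing through $v$, the face of the arrangement $\mathcal{A}(L\setminus\{\ell_1^v,\ell_2^v\})$ containing the point $v$ has size at most $5$.
   Context: For a set of lines $L$, $\mathcal{A}(L)$ denotes the cell decomposition of the projective plane induced by the lines; its vertices are the pairwise intersection points of lines in $L$. The size of a face is its number of edges (equivalently, of vertices on its boundary). For a vertex $v\in\mathcal{A}(L)$ lying on the lines $\ell_1^v,\ell_2^v\in L$, the zone complexity $C(v)$ is the size of the face of $\mathcal{A}(L\setminus\{\ell_1^v,\ell_2^v\})$ containing the point $v$, and $C(L)=\min_{v} C(v)$ over all vertices $v$ of $\mathcal{A}(L)$ (so $L$ is assumed to contain at least two lines). *)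

(* Defs.v *)
From HB Require Import structures.
From mathcomp Require Import all_boot all_order all_algebra.
From mathcomp Require Import all_classical all_reals all_analysis.
Set Implicit Arguments. Unset Strict Implicit. Unset Printing Implicit Defensive.
Import Order.TTheory GRing.Theory Num.Theory.
Import numFieldTopology.Exports numFieldNormedType.Exports.
Local Open Scope classical_set_scope.
Local Open Scope ring_scope.

(* Model of the real projective plane: a point is a nonzero vector x of R^3
   (up to nonzero scaling), a line is given by a nonzero normal vector a,
   and the point x lies on the line a iff  a . x = 0. *)

Definition dot (R : realType) (u v : 'rV[R]_3) : R := \sum_(k < 3) u 0 k * v 0 k.

Definition on_line (R : realType) (a x : 'rV[R]_3) : Prop := x != 0 /\ dot a x = 0.

Definition general_position (R : realType) (n : nat) (a : 'I_n -> 'rV[R]_3) : Prop :=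
  [/\ forall i, a i != 0,
      forall i j, i != j -> ~ (forall x, on_line (a i) x <-> on_line (a j) x)
    & forall i j k, i != j -> j != k -> i != k ->
        ~ (exists x, [/\ on_line (a i) x, on_line (a j) x & on_line (a k) x])].

Definition arr_complement (R : realType) (n : nat) (a : 'I_n -> 'rV[R]_3)
    (P : 'I_n -> bool) : set 'rV[R]_3 :=
  [set x | x != 0 /\ forall k, P k -> dot (a k) x != 0].

(* The face of A(P) containing the point v (v off the lines of P), as the cone
   in R^3 \ {0} over it: the preimage in R^3 \ {0} of the connected component of
   RP^2 \ (union of lines) containing [v], namely the union of the connected
   components of v and -v in the cone complement. *)
Definition face_cone (R : realType) (n : nat) (a : 'I_n -> 'rV[R]_3)
    (P : 'I_n -> bool) (v : 'rV[R]_3) : set 'rV[R]_3 :=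
  connected_component (arr_complement a P) v `|`
  connected_component (arr_complement a P) (- v).

(* Vertex {i,j} (i < j, both lines in P) of A(P) lies on the boundary of the
   face containing v: its point (any nonzero common point of lines i and j)
   lies in the closure of the face (closure in RP^2, computed on the cone). *)
Definition vertex_on_face (R : realType) (n : nat) (a : 'I_n -> 'rV[R]_3)
    (P : 'I_n -> bool) (v : 'rV[R]_3) (i j : 'I_n) : Prop :=
  exists w, [/\ on_line (a i) w, on_line (a j) w & closure (face_cone a P v) w].

(* Size of the face of A(P) containing v = number of vertices of A(P) on its
   boundary (vertices of A(P) are indexed by pairs i < j of lines of P, which
   give distinct points in general position). *)
Definition face_size (R : realType) (n : nat) (a : 'I_n -> 'rV[R]_3)
    (P : 'I_n -> bool) (v : 'rV[R]_3) : nat :=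
  #|[set ij : 'I_n * 'I_n | [&& (ij.1 < ij.2)%N, P ij.1, P ij.2 &
                               `[< vertex_on_face a P v ij.1 ij.2 >] ] ]|.

Definition zone_complexity (R : realType) (n : nat) (a : 'I_n -> 'rV[R]_3)
    (i j : 'I_n) (v : 'rV[R]_3) : nat :=
  face_size a (fun k => (k != i) && (k != j)) v.

(* Main.v *)
(* Work with the regions cut out on the sphere, encoded by sign vectors, whose corners
   are read off the chirotope.  If the four faces around a vertex have sizes adding up to
   [m], the merged face has [m - 12] corners, so it suffices to find [m <= 17].

   The size of a face minus 4, summed over all regions, is negative: every vertex lies
   on four regions and there are more regions than vertices.  If all vertices had
   [m >= 18], this would be contradicted by discharging: each large face sends
   charge through its edges to the triangles next to them or, when the edge separates
   two larger faces, to the triangles touching its ends.  The sums being at least 18,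
   every triangle receives its deficit 1; besides this one needs that two triangles are never
   adjacent and that a quadrilateral has no triangles on opposite sides, because two lines
   meet only once. *)
From HB Require Import structures.
From mathcomp Require Import all_boot.
From mathcomp Require Import zify.

Set Implicit Arguments.
Unset Strict Implicit.
Unset Printing Implicit Defensive.

(** * Sign vectors and their corners *)

Section Flip.

Variable I : finType.
Implicit Types (s : {ffun I -> bool}) (i j : I).

Definition flip i s : {ffun I -> bool} := [ffun k => s k (+) (k == i)].

Lemma flipE i s k : flip i s k = s k (+) (k == i).
Proof. by rewrite ffunE. Qed.

Lemma flipK i : involutive (flip i).
Proof. by move=> s; apply/ffunP=> k; rewrite !flipE -addbA addbb addbF. Qed.

Lemma flipC i j s : flip i (flip j s) = flip j (flip i s).
Proof. by apply/ffunP=> k; rewrite !flipE addbAC. Qed.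

Definition negv s : {ffun I -> bool} := [ffun k => ~~ s k].

Lemma negvK : involutive negv.
Proof. by move=> s; apply/ffunP=> k; rewrite !ffunE negbK. Qed.

End Flip.

Lemma card_set3 (I : finType) (i j k : I) : uniq [:: i; j; k] -> #|[set i; j; k]| = 3.
Proof. by move/card_uniqP=> /= h; rewrite -[RHS]h; apply: eq_card => x; rewrite !inE orbA. Qed.

Section Vertices.

Variables (I : finType) (P : I -> I -> I -> bool).
Implicit Types (s : {ffun I -> bool}) (i j k l : I).

(* [P i j k] is the sign on line [k] of a chosen representative of the vertex [i, j];
   its antipode has the opposite signs.  [s] is the sign vector of a region of the
   sphere, and [vtx s i j] says that one of the two is a corner of that region. *)
Definition vtx s i j : bool :=
  (i != j) && [exists e, forall k, (k != i) && (k != j) ==> (s k == e (+) P i j k)].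

Lemma vtxP s i j :
  reflect (i != j /\ exists e, forall k, k != i -> k != j -> s k = e (+) P i j k)
          (vtx s i j).
Proof.
apply: (iffP andP) => -[ij].
  case/existsP=> e /forallP h; split=> //; exists e => k ki kj.
  by apply/eqP; move: (h k); rewrite ki kj.
case=> e h; split=> //; apply/existsP; exists e; apply/forallP=> k.
by apply/implyP=> /andP[ki kj]; rewrite h.
Qed.

(** The side of a region on line [i] is recorded by the lines crossing [i] at its endpoints. A sign
    vector without corners gets size 0, so sums may run over all sign vectors. *)
Definition ends s i : {set I} := [set j | vtx s i j].
Definition facets s : {set I} := [set i | ends s i != set0].
Definition size_of s : nat := #|facets s|.

Lemma vtx_neq s i j : vtx s i j -> i != j.
Proof. by case/andP. Qed.

Lemma vtx_flipl s i j : vtx (flip i s) i j = vtx s i j.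
Proof.
apply/vtxP/vtxP=> -[ij [e h]]; split=> //; exists e => k ki kj;
  by move: (h k ki kj); rewrite !flipE (negbTE ki) addbF.
Qed.

Lemma vtx_flipr s i j : vtx (flip j s) i j = vtx s i j.
Proof.
apply/vtxP/vtxP=> -[ij [e h]]; split=> //; exists e => k ki kj;
  by move: (h k ki kj); rewrite !flipE (negbTE kj) addbF.
Qed.

Lemma vtx_negv s i j : vtx (negv s) i j = vtx s i j.
Proof.
apply/vtxP/vtxP=> -[ij [e h]]; split=> //; exists (~~ e) => k ki kj;
  by move: (h k ki kj); rewrite ffunE addNb => <-; rewrite ?negbK.
Qed.

Lemma facetP s i : reflect (exists j, vtx s i j) (i \in facets s).
Proof.
rewrite inE; apply: (iffP (set0Pn _)) => -[j]; first by rewrite inE; exists j.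
by move=> h; exists j; rewrite inE.
Qed.

Lemma vtx_facet s i j : vtx s i j -> i \in facets s.
Proof. by move=> h; apply/facetP; exists j. Qed.

Lemma facet_flip s i : (i \in facets (flip i s)) = (i \in facets s).
Proof. by apply/facetP/facetP=> -[j]; rewrite ?vtx_flipl => h; exists j; rewrite ?vtx_flipl. Qed.

Lemma size_of_sum s : size_of s = \sum_i (i \in facets s : nat).
Proof.
rewrite /size_of -sum1_card big_mkcond /=.
by apply: eq_bigr => i _; case: (i \in _).
Qed.

(** What is kept of the geometry: signs that alternate like a determinant, and the fact that a side
    with one end has another. *)
Hypothesis P_swap : forall i j k, uniq [:: i; j; k] -> P j i k = ~~ P i j k.
Hypothesis P_rot : forall i j k, uniq [:: i; j; k] -> P i k j = ~~ P i j k.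
Hypothesis P_second : forall s i j, vtx s i j -> exists2 k, k != j & vtx s i k.

Lemma vtx_sym s i j : vtx s i j = vtx s j i.
Proof.
have H i' j' : vtx s i' j' -> vtx s j' i'.
  case/vtxP=> ij [e h]; apply/vtxP; split; first by rewrite eq_sym.
  exists (~~ e) => k ki kj; rewrite h // (P_swap (i := i')) ?addbN ?addNb ?negbK //.
  by rewrite /= !inE negb_or ij eq_sym kj eq_sym ki.
by apply/idP/idP; apply: H.
Qed.

(* The chirotope signs of [i j k], [i j l], [i k l] would have to satisfy
   incompatible product relations. *)
Lemma vtx_at_most2 s i j k l :
  vtx s i j -> vtx s i k -> vtx s i l -> uniq [:: j; k; l] -> False.
Proof.
case/vtxP=> ij [ej hj] /vtxP[ik [ek hk]] /vtxP[il [el hl]].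
rewrite /= !inE negb_or => /andP[/andP[jk jl] /andP[kl _]].
have U x y : i != x -> i != y -> x != y -> uniq [:: i; x; y].
  by move=> a b c; rewrite /= !inE negb_or a b c.
have [/= ji ki li] : [/\ j != i, k != i & l != i] by rewrite ![_ == i]eq_sym.
have [/= kj lj lk] : [/\ k != j, l != j & l != k] by rewrite (eq_sym k) ![l == _]eq_sym.
move: (hj k ki kj) (hj l li lj) (hk j ji jk) (hk l li lk) (hl j ji jl) (hl k ki kl).
rewrite (P_rot (U j k ij ik jk)) (P_rot (U j l ij il jl)) (P_rot (U k l ik il kl)).
by case: (s j) (s k) (s l) (P i j k) (P i j l) (P i k l) ej ek el {hj hk hl}
  => [] [] [] [] [] [] [] [] [].
Qed.

Lemma card_ends s i j : vtx s i j -> #|ends s i| = 2.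
Proof.
move=> h; have [k kj hk] := P_second h.
suff -> : ends s i = [set j; k] by rewrite cards2 eq_sym kj.
apply/setP=> l; rewrite !inE; apply/idP/idP; last first.
  by case/orP=> /eqP ->.
move=> hl; apply/negP=> /negP; rewrite negb_or => /andP[lj lk].
apply: (vtx_at_most2 h hk hl).
by rewrite /= !inE negb_or eq_sym kj eq_sym lj eq_sym lk.
Qed.

Lemma card_ends_facet s i : #|ends s i| = (i \in facets s).*2.
Proof.
case: (boolP (i \in facets s)) => [/facetP[j /card_ends->] //|].
by rewrite inE negbK => /eqP->; rewrite cards0.
Qed.

Lemma size_of_ge3 s i j : vtx s i j -> 3 <= size_of s.
Proof.
move=> h; have [k kj hk] := P_second h.
have <- : #|[set i; j; k]| = 3.
  by rewrite card_set3 //= !inE negb_or (vtx_neq h) (vtx_neq hk) eq_sym kj.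
apply/subset_leq_card/subsetP=> x; rewrite !in_setU !in_set1.
case/orP=> [/orP[]|] /eqP->; first exact: vtx_facet h.
  by apply: (@vtx_facet _ _ i); rewrite vtx_sym.
by apply: (@vtx_facet _ _ i); rewrite vtx_sym.
Qed.

(** The second end of side [j] is a facet other than [i] and [j], which leaves only [k]. *)
Lemma triangleP s i j : size_of s = 3 -> vtx s i j ->
  exists k, [/\ facets s = [set i; j; k], uniq [:: i; j; k], vtx s i k & vtx s j k].
Proof.
move=> s3 h; have [k kj hk] := P_second h.
have ij := vtx_neq h; have ik := vtx_neq hk.
have Ef : facets s = [set i; j; k].
  apply/eqP; rewrite eq_sym eqEcard -/(size_of s) s3 card_set3 ?andbT; last first.
    by rewrite /= !inE negb_or ij ik eq_sym kj.
  apply/subsetP=> x; rewrite !in_setU !in_set1.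
  case/orP=> [/orP[]|]/eqP->; first exact: vtx_facet h.
    by apply: (@vtx_facet _ _ i); rewrite vtx_sym.
  by apply: (@vtx_facet _ _ i); rewrite vtx_sym.
exists k; split=> //; first by rewrite /= !inE negb_or ij ik eq_sym kj.
have [l li hl] : exists2 l, l != i & vtx s j l by apply: P_second; rewrite vtx_sym.
have : l \in facets s by apply: (@vtx_facet _ _ j); rewrite vtx_sym.
rewrite Ef !inE (negbTE li) /= => /orP[/eqP E|/eqP <- //].
by move: (vtx_neq hl); rewrite E eqxx.
Qed.

Hypothesis card_I : 5 <= #|I|.

Lemma pick_other (s : seq I) : size s <= 4 -> exists k, k \notin s.
Proof.
move=> le4; have : ~~ ([set: I] \subset [set x in s]).
  apply/negP=> /subset_leq_card; rewrite cardsT.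
  rewrite leqNgt; move/negP; apply.
  by apply: (leq_ltn_trans _ card_I); rewrite cardsE (leq_trans (card_size s)).
by case/subsetPn=> k _; rewrite inE => hk; exists k.
Qed.

(* The far vertex of two adjacent triangles would carry antipodal signs. *)
Lemma triangle_flip s i j : vtx s i j -> size_of s = 3 -> size_of (flip i s) <> 3.
Proof.
move=> h s3 t3; have [k [Ef U hik hjk]] := triangleP s3 h.
have h' : vtx (flip i s) i j by rewrite vtx_flipl.
have [k' [_ U' hik' hjk']] := triangleP t3 h'.
(* Both triangles have the same side on [i], hence the same ends there. *)
have ? : k' = k; last subst k'.
  apply/eqP/negP=> /negP kk; rewrite vtx_flipl in hik'.
  apply: (vtx_at_most2 h hik hik').
  move: U U'; rewrite /= !inE !negb_or !andbT => /andP[_ jk] /andP[_ jk'].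
  by rewrite jk jk' eq_sym kk.
(* Across [i] the sign on [m] is unchanged, so the same antipode of the vertex [j], [k] is used; yet
   the sign on [i] changes. *)
have [m] := @pick_other [:: i; j; k] isT.
rewrite !inE !negb_or => /and3P[mi mj mk].
move: U; rewrite /= !inE !negb_or andbT => /andP[/andP[ij ik] jk].
case/vtxP: hjk => _ [e he]; case/vtxP: hjk' => _ [e' he'].
move: (he m mj mk) (he' m mj mk) (he i ij ik) (he' i ij ik).
rewrite !flipE eqxx (negbTE mi).
by case: (s m) (s i) (P j k m) (P j k i) e e' {he he'} => [] [] [] [] [] [].
Qed.

(** The fourth side [l] cannot meet side [i], whose two ends are taken by [j] and [k]; so the two
    ends of [l] are on [j] and [k]. *)
Lemma size4_opposite s i j k : size_of s = 4 -> vtx s i j -> vtx s i k -> j != k ->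
  exists l, [/\ vtx s j l, vtx s k l & l != i].
Proof.
move=> s4 hj hk jk; have ij := vtx_neq hj; have ik := vtx_neq hk.
have S3 : #|[set i; j; k]| = 3.
  by rewrite card_set3 //= !inE negb_or ij ik jk.
have [l] : exists l, l \in facets s :\: [set i; j; k].
  apply/set0Pn; rewrite -card_gt0 cardsD.
  have := subset_leq_card (subsetIr (facets s) [set i; j; k]).
  by rewrite S3 -/(size_of s) s4; lia.
rewrite in_setD !in_setU !in_set1 !negb_or => /andP[/andP[/andP[li lj] lk] hl].
have sub : facets s \subset [set i; j; k; l].
  have E : [set i; j; k; l] = l |: [set i; j; k] by rewrite setUC.
  have : [set i; j; k; l] \subset facets s.
    apply/subsetP=> x; rewrite !in_setU !in_set1 => /orP[/orP[/orP[]|]|] /eqP-> //.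
    - exact: vtx_facet hj.
    - by apply: (@vtx_facet _ _ i); rewrite vtx_sym.
    - by apply: (@vtx_facet _ _ i); rewrite vtx_sym.
  move/subset_leqif_cards=> -[_]; rewrite E cardsU1 S3 -/(size_of s) s4 !inE.
  by rewrite (negbTE li) (negbTE lj) (negbTE lk) eqxx => /esym/eqP->.
have nil : ~~ vtx s i l.
  apply/negP=> h; apply: (vtx_at_most2 hj hk h).
  by rewrite /= !inE negb_or jk eq_sym lj eq_sym lk.
have ends_l : ends s l = [set j; k].
  case/facetP: hl => x hx; apply/eqP; rewrite eqEcard (card_ends hx) cards2 jk andbT.
  apply/subsetP=> y; rewrite inE => hy.
  have: y \in [set i; j; k; l].
    by apply: (subsetP sub); apply: (@vtx_facet _ _ l); rewrite vtx_sym.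
  rewrite !inE => /orP[/orP[/orP[]|]|] /eqP E; subst y; rewrite ?eqxx ?orbT //.
    by move: nil; rewrite vtx_sym hy.
  by move: (vtx_neq hy); rewrite eqxx.
have in_ends x : vtx s l x = (x \in ends s l) by rewrite inE.
exists l; rewrite (vtx_sym s j) (vtx_sym s k) !in_ends ends_l !inE !eqxx orbT.
by split.
Qed.

(* Two triangles on opposite sides j, k of a quadrilateral would make its other
   two sides i, l meet twice. *)
Lemma quad_triangles s i j k : size_of s = 4 -> vtx s i j -> vtx s i k -> j != k ->
  size_of (flip j s) = 3 -> size_of (flip k s) = 3 -> False.
Proof.
move=> s4 hj hk jk tj tk; have [l [jl kl li]] := size4_opposite s4 hj hk jk.
(* The triangle across [x] has the same ends on [x] as [s], namely on [i] and [l]; its apex is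
   therefore the vertex [i], [l]. *)
have far x : vtx s i x -> vtx s x l -> size_of (flip x s) = 3 -> vtx (flip x s) i l.
  move=> hx hxl tx; have hx' : vtx (flip x s) x i by rewrite vtx_flipl vtx_sym.
  have [m [_ U hm him]] := triangleP tx hx'.
  have [<- //|ml] := eqVneq m l; exfalso.
  rewrite !vtx_flipl in hx' hm; apply: (vtx_at_most2 hx' hm hxl).
  by move: U; rewrite /= !inE !negb_or ml (eq_sym i l) li !andbT => /andP[_ ->].
have [m] := @pick_other [:: i; j; k; l] isT.
rewrite !inE !negb_or => /and4P[mi mj mk ml].
case/vtxP: (far _ hj jl tj) => _ [e he]; case/vtxP: (far _ hk kl tk) => _ [e' he'].
have ji : j != i by rewrite eq_sym (vtx_neq hj).
move: (he m mi ml) (he' m mi ml) (he j ji (vtx_neq jl)) (he' j ji (vtx_neq jl)).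
rewrite !flipE eqxx (negbTE mj) (negbTE mk) (negbTE jk).
by case: (s m) (s j) (P i l m) (P i l j) e e' {he he'} => [] [] [] [] [] [].
Qed.

End Vertices.

(** * Counting regions *)

Section Shattering.

Variable I : finType.
Implicit Types (F : {set {ffun I -> bool}}) (S G : {set I}) (s b : {ffun I -> bool}).

(* Shattering in the strong sense: all patterns on [S] occur with one fixed pattern [b]
   outside [S]. *)
Definition shattered F S : bool :=
  [exists b : {ffun I -> bool}, forall s : {ffun I -> bool},
     [forall k, (k \notin S) ==> (s k == b k)] ==> (s \in F)].

Lemma shatteredP F S :
  reflect (exists b, forall s, (forall k, k \notin S -> s k = b k) -> s \in F)
          (shattered F S).
Proof.
apply: (iffP existsP) => -[b h]; exists b.
  move=> s sb; move/forallP/(_ s)/implyP: h; apply.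
  by apply/forallP=> k; apply/implyP=> /sb ->.
apply/forallP=> s; apply/implyP=> /forallP sb; apply: h => k kS.
by apply/eqP; move: (sb k); rewrite kS.
Qed.

Lemma shattered_sub F S S' : S' \subset S -> shattered F S -> shattered F S'.
Proof.
move=> sub /shatteredP[b h]; apply/shatteredP; exists b => s sb.
by apply: h => k kS; apply: sb; apply: contra kS; apply: (subsetP sub).
Qed.

(* Splitting [F] along a coordinate [x], shattered sets avoiding [x] are shattered by the
   union of the two halves, and the others, minus [x], by their intersection. *)
Lemma card_shattered F : #|[set S | shattered F S]| <= #|F|.
Proof.
(* Generalised to families supported on a set [G] of coordinates, for induction on its size;
   elsewhere the value is [false]. *)
suff H n : forall F G, #|G| = n -> (forall s, s \in F -> forall k, k \notin G -> s k = false) ->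
    #|[set S | shattered F S]| <= #|F|.
  by apply: (H #|[set: I]| F setT) => // s _ k; rewrite inE.
elim: n {F} => [|n IHn] F G cG supp.
  have [->|[s sF]] := set_0Vmem F.
    rewrite cards0 leqn0 cards_eq0 -subset0; apply/subsetP=> S; rewrite inE.
    by case/shatteredP=> b h; have := h b (fun _ _ => erefl); rewrite inE.
  apply: (@leq_trans #|[set set0 : {set I}]|); last first.
    by rewrite cards1 card_gt0; apply/set0Pn; exists s.
  apply/subset_leq_card/subsetP=> S; rewrite !inE => /shatteredP[b h].
  apply/set0Pn=> -[k kS].
  pose t : {ffun I -> bool} := [ffun l => if l == k then true else b l].
  have /supp/(_ k) : t \in F.
    by apply: h => l lS; rewrite ffunE; case: eqP lS => // ->; rewrite kS.
  by rewrite ffunE eqxx (cards0_eq cG) inE => /(_ isT).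
have [x xG] : exists x, x \in G by apply/set0Pn; rewrite -card_gt0 cG.
(* The two halves of [F] along [x], both normalised to [false] at [x] so that they can be
   compared. *)
pose F0 := [set s : {ffun I -> bool} | s \in F & ~~ s x].
pose F1 := [set s : {ffun I -> bool} | ~~ s x & flip x s \in F].
have cF : #|F0 :|: F1| + #|F0 :&: F1| = #|F|.
  rewrite cardsUI -(cardsID [set s : {ffun I -> bool} | s x] F) addnC; congr (_ + _).
    rewrite -(card_imset _ (can_inj (@flipK _ x))); apply: eq_card => s.
    rewrite !inE; apply/imsetP/idP => [[t]|/andP[sF sx]].
      by rewrite !inE => /andP[tx tF] ->; rewrite tF flipE eqxx addbT tx.
    exists (flip x s); last by rewrite flipK.
    by rewrite !inE flipK sF flipE eqxx addbT sx.
  by apply: eq_card => s; rewrite !inE andbC.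
have cG' : #|G :\ x| = n by move: cG; rewrite (cardsD1 x) xG => -[].
have supp0 s k : ~~ s x -> (s \in F) || (flip x s \in F) -> k \notin G :\ x -> s k = false.
  move=> sx; rewrite !inE negb_and negbK => sF /orP[/eqP->|kG]; first exact: negbTE.
  have kx : (k == x) = false by apply: contraNF kG => /eqP->.
  by case/orP: sF => /supp/(_ k kG) //; rewrite flipE kx addbF.
rewrite -cF -(cardsID [set S : {set I} | x \in S]) addnC leq_add //.
  apply: leq_trans (IHn _ _ cG' _); last first.
    by move=> s; rewrite !inE => /orP[/andP[h1 h2]|/andP[h1 h2]] k; apply: supp0 => //;
      rewrite ?h1 ?h2 ?orbT.
  apply/subset_leq_card/subsetP=> S; rewrite !inE => /andP[xS /shatteredP[b h]].
  apply/shatteredP; exists [ffun k => (k != x) && b k] => s sb.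
  have sx : s x = false by rewrite (sb x xS) ffunE eqxx.
  rewrite !inE sx /= andbT.
  case bx: (b x).
    suff -> : flip x s \in F by rewrite orbT.
    apply: h => k kS; rewrite flipE (sb k kS) ffunE.
    by case: eqP => //= [->|]; rewrite ?bx ?addbF.
  suff -> : s \in F by [].
  by apply: h => k kS; rewrite (sb k kS) ffunE; case: eqP => //= ->.
apply: leq_trans (IHn _ _ cG' _); last first.
  by move=> s; rewrite !inE => /andP[/andP[h1 h2] /andP[h3 h4]] k; apply: supp0 => //;
    rewrite ?h1.
rewrite -(@card_in_imset _ _ (fun S => S :\ x)); last first.
  move=> S S'; rewrite !inE => /andP[_ xS] /andP[_ xS'] E.
  by rewrite -(setD1K xS) E setD1K.
apply/subset_leq_card/subsetP=> S' /imsetP[S].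
rewrite !inE => /andP[/shatteredP[b h] xS] ->.
apply/shatteredP; exists [ffun k => (k != x) && b k] => s sb.
have sx : s x = false by rewrite sb ?ffunE ?eqxx // !inE eqxx.
have sF : s \in F.
  apply: h => k kS; rewrite sb ?inE ?(negbTE kS) ?andbF // ffunE.
  by case: eqP kS => //= ->; rewrite xS.
have fF : flip x s \in F.
  apply: h => k kS; rewrite flipE sb ?inE ?(negbTE kS) ?andbF // ffunE.
  by case: eqP kS => //= [->|_]; rewrite ?xS ?addbF.
by rewrite !inE sF fF sx.
Qed.

End Shattering.

Section Counting.

Variables (I : finType) (P : I -> I -> I -> bool).
Implicit Types (s t : {ffun I -> bool}) (i j k l : I).

Hypothesis P_swap : forall i j k, uniq [:: i; j; k] -> P j i k = ~~ P i j k.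
Hypothesis P_rot : forall i j k, uniq [:: i; j; k] -> P i k j = ~~ P i j k.
Hypothesis P_second : forall s i j, vtx P s i j -> exists2 k, k != j & vtx P s i k.
Hypothesis card_I : 5 <= #|I|.

Local Notation vtx := (vtx P).
Local Notation facets := (facets P).
Local Notation size_of := (size_of P).

Definition regions : {set {ffun I -> bool}} := [set s | facets s != set0].

Lemma vtx_regions s i j : vtx s i j -> s \in regions.
Proof. by move=> h; rewrite inE; apply/set0Pn; exists i; apply: vtx_facet h. Qed.

Lemma regions_vtx s : s \in regions -> exists i j, vtx s i j.
Proof. by rewrite inE => /set0Pn[i /facetP[j h]]; exists i, j. Qed.

Lemma size_of_out s : s \notin regions -> size_of s = 0.
Proof. by rewrite inE negbK /size_of => /eqP ->; rewrite cards0. Qed.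

(** The signs on [i] and [j] and the choice of antipode determine [s]; a third line [k] reveals the
    antipode. *)
Lemma card_vtx_le8 i j : i != j -> #|[set s | vtx s i j]| <= 8.
Proof.
move=> ij; have [k] := pick_other card_I (s := [:: i; j]) isT.
rewrite !inE negb_or => /andP[ki kj].
have <- : #|{: bool * bool * bool}| = 8 by rewrite !card_prod card_bool.
rewrite -(@card_in_imset _ _ (fun s : {ffun I -> bool} => (s i, s j, s k))).
  exact: max_card.
move=> s t; rewrite !inE => /vtxP[_ [e he]] /vtxP[_ [e' he']] [si sj sk].
have ee : e = e'.
  by move: (he k ki kj) (he' k ki kj); rewrite sk => -> /(can_inj (addbK _)).
apply/ffunP=> l; have [->//|li] := eqVneq l i; have [->//|lj] := eqVneq l j.
by rewrite he // he' // ee.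
Qed.

Lemma sum_ends s : \sum_i \sum_j (vtx s i j : nat) = (size_of s).*2.
Proof.
rewrite size_of_sum -muln2 big_distrl /=.
apply: eq_bigr => i _; rewrite muln2 -(card_ends_facet P_rot P_second) -sum1_card [RHS]big_mkcond /=.
by apply: eq_bigr => j _; rewrite inE; case: (vtx s i j).
Qed.

(** Double counting of triples of a region and an ordered corner: each region has twice its size of
    them, each ordered pair of lines at most 8. *)
Lemma sum_size_le : \sum_(s in regions) size_of s <= 4 * (#|I| * (#|I|.-1)).
Proof.
rewrite -leq_double -mul2n big_distrr /= big_mkcond /=.
apply: (@leq_trans (\sum_i \sum_j \sum_s (vtx s i j : nat))).
  rewrite (eq_bigr (fun i => \sum_s \sum_j (vtx s i j : nat))); last first.
    by move=> i _; rewrite exchange_big.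
  rewrite exchange_big /=; apply: leq_sum => s _.
  by rewrite sum_ends; case: ifP => // _; rewrite mul2n.
have bnd i j : \sum_s (vtx s i j : nat) <= (i != j) * 8.
  have [->|ij] := eqVneq i j.
    rewrite big1 // => s _; case: (boolP (vtx s j j)) => // /vtx_neq.
    by rewrite eqxx.
  rewrite mul1n; apply: leq_trans (card_vtx_le8 ij).
  rewrite -sum1_card [X in _ <= X]big_mkcond /=.
  by apply: leq_sum => s _; rewrite inE; case: (vtx s i j).
apply: (@leq_trans (\sum_(i : I) \sum_(j : I) (i != j) * 8)).
  by apply: leq_sum => i _; apply: leq_sum => j _.
have E i : \sum_(j : I) (i != j) * 8 = #|I|.-1 * 8.
  rewrite -big_distrl /= ; congr (_ * 8).
  rewrite -(cardC1 i) -sum1_card [RHS]big_mkcond /=.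
  by apply: eq_bigr => j _; rewrite inE eq_sym; case: eqP.
by rewrite (eq_bigr (fun=> #|I|.-1 * 8)) // sum_nat_const mulnA mulnC -mul2n [X in _ <= X]mulnA leqnn.
Qed.

Lemma card_small_subsets (A : {set I}) :
  1 + #|A| + 'C(#|A|, 2) <= #|[set S : {set I} | S \subset A & #|S| <= 2]|.
Proof.
pose D (k : nat) := [set S : {set I} | S \subset A & #|S| == k].
have cD (k : nat) : #|D k| = 'C(#|A|, k) by apply: cards_draws.
have d01 : [disjoint D 0 & D 1].
  by rewrite -setI_eq0 -subset0; apply/subsetP=> S; rewrite !inE; lia.
have d2 : [disjoint D 0 :|: D 1 & D 2].
  by rewrite -setI_eq0 -subset0; apply/subsetP=> S; rewrite !inE; lia.
apply: (@leq_trans #|D 0 :|: D 1 :|: D 2|).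
  have [_ c2] := leq_card_setU (D 0 :|: D 1) (D 2).
  have [_ c1] := leq_card_setU (D 0) (D 1).
  move: c1 c2; rewrite d01 d2 !cD bin0 bin1 => /eqP -> /eqP ->; lia.
by apply/subset_leq_card/subsetP=> S; rewrite !inE; lia.
Qed.

Lemma regions_negv s : (negv s \in regions) = (s \in regions).
Proof.
by apply/idP/idP=> /regions_vtx[i [j]]; rewrite ?vtx_negv => h;
   apply: (@vtx_regions _ i j); rewrite ?vtx_negv.
Qed.

(* The regions on one side of a line [x] shatter every set of at most two other lines. *)
Lemma card_regions_ge : 2 + #|I| * #|I|.-1 <= #|regions|.
Proof.
have [x _] := pick_other card_I (s := [::]) isT.
pose R1 := [set s in regions | s x].
(* The antipodal map exchanges the two sides of [x]. *)
have cR : #|regions| = #|R1|.*2.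
  rewrite -(cardsID [set s : {ffun I -> bool} | s x] regions) -addnn; congr (_ + _).
    by apply: eq_card => s; rewrite !inE.
  rewrite -[RHS](card_imset _ (can_inj (@negvK I))); apply: eq_card => s.
  rewrite in_setD in_set; apply/andP/imsetP=> [[sx sR]|[t]].
    exists (negv s); last by rewrite negvK.
    by rewrite in_set regions_negv sR ffunE.
  by rewrite in_set => /andP[tR tx] ->; split; rewrite ?ffunE ?tx ?regions_negv.
pose A := [set~ x].
have cA : #|A| = #|I|.-1 by rewrite cardsC1.
have shat2 i j : i \in A -> j \in A -> i != j -> shattered R1 [set i; j].
  rewrite !inE => ix jx ij; apply/shatteredP.
  (* The four regions around the representative of the vertex [i], [j] that is positive on [x]. *)
  exists [ffun k => ~~ P i j x (+) P i j k] => s h.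
  have {}h k : k != i -> k != j -> s k = ~~ P i j x (+) P i j k.
    by move=> ki kj; rewrite h ?ffunE // !inE negb_or ki kj.
  have hv : vtx s i j by apply/vtxP; split=> //; exists (~~ P i j x) => k; apply: h.
  rewrite in_set (vtx_regions hv) h 1?eq_sym //.
  by case: (P i j x).
have shat1 i : i \in A -> shattered R1 [set i].
  move=> iA; have [j] := pick_other card_I (s := [:: x; i]) isT.
  rewrite !inE negb_or => /andP[jx ji].
  apply: (@shattered_sub _ _ [set i; j]); first by apply/subsetP=> k; rewrite !inE => ->.
  by apply: shat2 => //; rewrite ?inE // eq_sym.
have := card_shattered R1; have := card_small_subsets A; rewrite cA => c1 c2.
have : #|[set S : {set I} | S \subset A & #|S| <= 2]| <= #|[set S | shattered R1 S]|.
  apply/subset_leq_card/subsetP=> S; rewrite !inE => /andP[SA].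
  have [->|[i iS]] := set_0Vmem S.
    have [i] := pick_other card_I (s := [:: x]) isT; rewrite inE => ix _.
    by apply: (@shattered_sub _ _ [set i]); rewrite ?sub0set // shat1 // !inE.
  rewrite (cardsD1 i) iS => cS.
  have [E|[j]] := set_0Vmem (S :\ i).
    by rewrite -(setD1K iS) E setU0; apply: shat1; apply: (subsetP SA).
  rewrite in_setD1 => /andP[ji jS].
  have -> : S = [set i; j].
    apply/esym/eqP; rewrite eqEcard cards2 eq_sym ji (cardsD1 i S) iS cS andbT.
    by apply/subsetP=> k; rewrite !inE => /orP[]/eqP->.
  by apply: shat2; rewrite 1?eq_sym //; apply: (subsetP SA).
move=> c3; rewrite cR.
(* With [n] lines, twice 1 + (n - 1) + C(n - 1, 2) is 2 + n (n - 1). *)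
have c4 : 'C(#|I|.-1, 2).*2 = #|I|.-1 * #|I|.-2.
  rewrite bin2 halfK oddM; case: (#|I|.-1) => [|m] //=.
  by rewrite andNb subn0.
lia.
Qed.

End Counting.

(** * Discharging *)

(* Charge that a face of size [m] gives through each of its edges, in units of
   1/180; it is at most 180 (m - 4) / m. *)
Definition share (m : nat) : nat := nth 0 [:: 0; 0; 0; 0; 0; 36; 60; 72; 90] (minn m 8).

(* The part of [share m] sent through one end of an edge to the opposite triangle
   there, [h] being the size of the face across the edge: a quadrilateral across
   the edge leaves room for only one such triangle. *)
Definition opp_share (h m : nat) : nat :=
  if h == 4 then (share m).*2 %/ 3 else share m %/ 2.

(* The part received, through a corner shared with the neighbours of sizes [a] and
   [b], by a triangle opposite a face of size [o]: from that face via one of its edges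
   and from the neighbour of size [a]. *)
Definition corner_share (a b o : nat) : nat :=
  (o != 3) * (opp_share b o + share a %/ 3).

(* What a triangle receives from neighbours of sizes [a], [b], [c] across its edges
   and [oc], [oa], [ob] across its corners. *)
Definition income (a b c oc oa ob : nat) : nat :=
  share a + share b + share c
    + (corner_share a b oc + corner_share a c ob)
    + (corner_share b a oc + corner_share b c oa)
    + (corner_share c a ob + corner_share c b oa).

Lemma share_minn m : share (minn m 8) = share m.
Proof. by rewrite /share -minnA minnn. Qed.

Lemma corner_share_minn a b o :
  corner_share (minn a 8) (minn b 8) (minn o 8) = corner_share a b o.
Proof.
rewrite /corner_share /opp_share !share_minn.
have E c : c < 8 -> forall m, (minn m 8 == c) = (m == c) by lia.
by rewrite !E.
Qed.

Lemma mul_share m : 3 <= m -> m * share m <= 180 * (m - 4).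
Proof.
move=> m3; have [m8|m8] := leqP 8 m; first by rewrite /share (minn_idPr m8) /=; lia.
by move: m3 m8; do 8 (case: m => [|m] //).
Qed.

(* All sizes may be truncated at 8, which leaves finitely many cases. *)
Lemma triangle_receipt a b c oc oa ob : 4 <= a -> 4 <= b -> 4 <= c ->
  3 <= oc -> 3 <= oa -> 3 <= ob ->
  15 <= a + b + oc -> 15 <= b + c + oa -> 15 <= a + c + ob ->
  180 <= income a b c oc oa ob.
Proof.
have : all (fun a => all (fun b => all (fun c => all (fun oc => all (fun oa =>
   all (fun ob => [&& 15 <= a + b + oc, 15 <= b + c + oa & 15 <= a + c + ob] ==>
     (180 <= income a b c oc oa ob))
   (iota 3 6)) (iota 3 6)) (iota 3 6)) (iota 4 5)) (iota 4 5)) (iota 4 5).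
  by vm_compute.
move=> H a4 b4 c4 oc3 oa3 ob3 hc ha hb.
have [ia ib ic] : [/\ minn a 8 \in iota 4 5, minn b 8 \in iota 4 5 & minn c 8 \in iota 4 5].
  by split; rewrite mem_iota; lia.
have [ja jb jc] : [/\ minn oa 8 \in iota 3 6, minn ob 8 \in iota 3 6 & minn oc 8 \in iota 3 6].
  by split; rewrite mem_iota; lia.
move/allP/(_ _ ia)/allP/(_ _ ib)/allP/(_ _ ic)/allP/(_ _ jc)/allP/(_ _ ja)/allP/(_ _ jb): H.
rewrite /income !corner_share_minn !share_minn => /implyP; apply.
lia.
Qed.

Lemma leq_sum3 (I : finType) (G : I -> nat) i j k :
  uniq [:: i; j; k] -> G i + G j + G k <= \sum_x G x.
Proof.
rewrite /= !inE negb_or andbT => /andP[/andP[ij ik] jk].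
rewrite (bigD1 i) //= (bigD1 j) 1?eq_sym //= (bigD1 k) /=; first by lia.
by rewrite eq_sym ik eq_sym jk.
Qed.

(** The load of an edge with ends [j], [k]: [tj], [tk] mark triangles across the adjacent sides of
    the giving face, [oj], [ok] triangles opposite it at the ends. Each end has at most one of the
    two kinds, so the worst loads are two halves, or two thirds plus one third. *)
Lemma split_share (tj tk oj ok t q : bool) g :
  ~~ (tj && oj) -> ~~ (tk && ok) -> (q -> ~~ (oj && ok)) ->
  oj * (~~ t * (if q then g.*2 %/ 3 else g %/ 2)) + tj * (g %/ 3)
  + (ok * (~~ t * (if q then g.*2 %/ 3 else g %/ 2)) + tk * (g %/ 3)) <= g.
Proof.
have [h1 h2] : g.*2 %/ 3 + g %/ 3 <= g /\ g %/ 2 + g %/ 2 <= g by split; lia.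
case: q tj tk oj ok t => [] [] [] [] [] [] //= _ _;
  try (by move=> /(_ isT)); move=> _; lia.
Qed.

Lemma leq_add_true (b c : bool) m n :
  b -> c -> m + n <= b * (true * m) + c * (true * n).
Proof. by move=> -> ->; rewrite !mul1n. Qed.

(* The factors 1 are those left by the boolean indicators in [triangle_charge]. *)
Lemma leq_add_rows n a b c x y z x' y' z' :
  n <= a + b + c + x + y + z -> x <= x' -> y <= y' -> z <= z' ->
  1 * n <= 1 * 1 * a + x' + (1 * 1 * b + y') + (1 * 1 * c + z').
Proof. lia. Qed.

(** Truncated subtraction makes [f s - 4] vanish on triangles; the indicator of size 3 restores
    their deficit. *)
Lemma charge_balance (T : finType) (A : {set T}) (f : T -> nat) :
  \sum_(s in A) (f s == 3) * 180 <= \sum_(s in A) 180 * (f s - 4) ->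
  (forall s, s \in A -> 3 <= f s) -> 4 * #|A| <= \sum_(s in A) f s.
Proof.
move=> le_charge f3.
have E : \sum_(s in A) ((f s == 3) * 180 + 180 * f s) =
         \sum_(s in A) (180 * (f s - 4) + 720).
  by apply: eq_bigr => s /f3; case: eqP; lia.
move: E le_charge.
rewrite big_split [in X in _ = X]big_split /= sum_nat_const -big_distrr /=.
lia.
Qed.

Section Discharging.

Variables (I : finType) (P : I -> I -> I -> bool).
Implicit Types (s t : {ffun I -> bool}) (i j k l : I).

Hypothesis P_swap : forall i j k, uniq [:: i; j; k] -> P j i k = ~~ P i j k.
Hypothesis P_rot : forall i j k, uniq [:: i; j; k] -> P i k j = ~~ P i j k.
Hypothesis P_second : forall s i j, vtx P s i j -> exists2 k, k != j & vtx P s i k.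
Hypothesis card_I : 5 <= #|I|.

Local Notation vtx := (vtx P).
Local Notation facets := (facets P).
Local Notation size_of := (size_of P).
Local Notation tri s := (size_of s == 3).

(** All that [s] gives through its side [i]: its share to a triangle across it, or else parts to
    triangles at the two ends, either opposite [s] or across the next side of [s]. *)
Lemma edge_budget s i :
  (i \in facets s) * (tri (flip i s)) * share (size_of s)
  + \sum_j vtx s i j *
      (tri (flip i (flip j s)) * (~~ tri s * opp_share (size_of (flip i s)) (size_of s))
       + tri (flip j s) * (~~ tri (flip i s) * (share (size_of s) %/ 3)))
  <= (i \in facets s) * share (size_of s).
Proof.
have [|iN] := boolP (i \in facets s); last first.
  rewrite !mul0n add0n big1 // => j _; case: (boolP (vtx s i j)) => // /vtx_facet.
  by rewrite (negbTE iN).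
case/facetP=> j hj; have [k kj hk] := P_second hj.
rewrite (bigD1 j) //= (bigD1 k) //= big1 ?addn0 => [|l /andP[lj lk]]; last first.
  case: (boolP (vtx s i l)) => // hl; exfalso.
  apply: (vtx_at_most2 P_rot hj hk hl).
  by rewrite /= !inE negb_or eq_sym kj eq_sym lj eq_sym lk.
rewrite hj hk !mul1n.
have noadj x : vtx s i x -> tri (flip x s) -> ~~ tri (flip i (flip x s)).
  move=> hx /eqP tx; apply/negP=> /eqP.
  have hx' : vtx (flip x s) i x by rewrite vtx_flipr.
  exact: (triangle_flip P_swap P_rot P_second card_I hx' tx).
have noadj' x : vtx s i x -> tri (flip i s) -> ~~ tri (flip i (flip x s)).
  move=> hx /eqP tx; rewrite flipC; apply/negP=> /eqP.
  have hx' : vtx (flip i s) x i by rewrite vtx_sym // vtx_flipl.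
  exact: (triangle_flip P_swap P_rot P_second card_I hx' tx).
(* The two triangles in question lie across the opposite sides [j] and [k] of this quadrilateral. *)
have quad : size_of (flip i s) = 4 ->
    ~~ (tri (flip i (flip j s)) && tri (flip i (flip k s))).
  move=> s4; apply/negP=> /andP[/eqP tj /eqP tk].
  rewrite flipC in tj; rewrite flipC in tk.
  have [hj' hk'] : vtx (flip i s) i j /\ vtx (flip i s) i k by rewrite !vtx_flipl.
  apply: (quad_triangles P_swap P_rot P_second card_I s4 hj' hk' _ tj tk).
  by rewrite eq_sym.
(* A triangle across [i] takes the whole share: no triangle opposite [s] can be adjacent to it, and
   the thirds are switched off. *)
rewrite /opp_share; have [ti|_] := boolP (tri (flip i s)).
  rewrite (negbTE (noadj' j hj ti)) (negbTE (noadj' k hk ti)).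
  by rewrite !(mul0n, muln0, addn0, mul1n, muln1).
move: (noadj j hj) (noadj k hk) => nj nk.
rewrite !(muln0, mul0n, add0n, mul1n).
have {nj} : ~~ (tri (flip j s) && tri (flip i (flip j s))).
  by apply/negP=> /andP[/nj/negP].
have {nk} : ~~ (tri (flip k s) && tri (flip i (flip k s))).
  by apply/negP=> /andP[/nk/negP].
move=> nk nj.
have {}quad : size_of (flip i s) == 4 -> ~~ (tri (flip i (flip j s)) && tri (flip i (flip k s))).
  by move/eqP.
exact: split_share nj nk quad.
Qed.

Hypothesis heavy : forall s i j, vtx s i j ->
  18 <= size_of s + size_of (flip i s) + size_of (flip j s) + size_of (flip i (flip j s)).

(** The three sides of the triangle give the three rows of the sum. Every corner occurs in two rows,
    once for each neighbour, as in [income]. *)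
Lemma triangle_charge s :
  tri s * 180 <= \sum_i
    ((i \in facets s) * tri s * share (size_of (flip i s))
     + \sum_j vtx s i j * (tri s *
         corner_share (size_of (flip i s)) (size_of (flip j s)) (size_of (flip i (flip j s))))).
Proof.
case: eqP => [s3|]; last by rewrite mul0n.
have [i [j h]] : exists i j, vtx s i j by apply: regions_vtx; rewrite inE -card_gt0 -/(size_of s) s3.
have [k [Ef U hik hjk]] := triangleP P_swap P_second s3 h.
have fi x : x \in [:: i; j; k] -> x \in facets s by rewrite Ef !inE orbA.
apply: leq_trans (leq_sum3 _ U).
have sum2 (G : I -> nat) x y : x != y -> G x + G y <= \sum_z G z.
  by move=> xy; rewrite (bigD1 x) //= (bigD1 y) 1?eq_sym //=; lia.
have [ij jk ik] : [/\ i != j, j != k & i != k].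
  by move: U; rewrite /= !inE negb_or andbT => /andP[/andP[-> ->] ->].
have hji : vtx s j i by rewrite vtx_sym.
have hki : vtx s k i by rewrite vtx_sym.
have hkj : vtx s k j by rewrite vtx_sym.
have ge4 x y : vtx s x y -> 4 <= size_of (flip x s).
  move=> hx; have hx' : vtx (flip x s) x y by rewrite vtx_flipl.
  have := size_of_ge3 P_swap P_second hx'.
  by rewrite leq_eqVlt => /orP[/eqP/esym/(triangle_flip P_swap P_rot P_second card_I hx s3)|].
have ge3 x y : vtx s x y -> 3 <= size_of (flip x (flip y s)).
  by move=> hx; apply: (@size_of_ge3 _ _ P_swap P_second _ x y); rewrite vtx_flipl vtx_flipr.
(* Removing the 3 of the triangle from 18 leaves the bounds 15 of [triangle_receipt]. *)
have w3 := heavy h; have w2 := heavy hjk; have w1 := heavy hik; rewrite s3 in w1 w2 w3.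
have R := triangle_receipt (ge4 _ _ h) (ge4 _ _ hji) (ge4 _ _ hki)
   (ge3 _ _ h) (ge3 _ _ hjk) (ge3 _ _ hik) w3 w2 w1.
pose C x y := corner_share (size_of (flip x s)) (size_of (flip y s)) (size_of (flip x (flip y s))).
have row x y z : vtx s x y -> vtx s x z -> y != z ->
    C x y + C x z <= \sum_u vtx s x u * (true * C x u).
  move=> hy hz yz; apply: leq_trans (sum2 (fun u => vtx s x u * (true * C x u)) _ _ yz).
  exact: leq_add_true hy hz.
have Si := row i j k h hik jk.
have Sj := row j i k hji hjk ik; rewrite {1}/C (flipC j i) in Sj.
have Sk := row k i j hki hkj ij; rewrite /C (flipC k i) (flipC k j) in Sk.
rewrite !fi ?inE ?eqxx ?orbT //.
exact: leq_add_rows R Si Sj Sk.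
Qed.

(** The charge received by triangles is re-indexed by its givers and then bounded edge by edge. *)
Lemma discharging : \sum_s tri s * 180 <= \sum_(s in regions P) 180 * (size_of s - 4).
Proof.
eapply leq_trans; first by apply: leq_sum => s _; exact: triangle_charge.
under eq_bigr => s _ do rewrite big_split.
rewrite big_split /=.
(* Flipping [i] exchanges receiver and giver across the edge. *)
have -> : \sum_s \sum_i (i \in facets s) * tri s * share (size_of (flip i s)) =
          \sum_s \sum_i (i \in facets s) * tri (flip i s) * share (size_of s).
  rewrite exchange_big [RHS]exchange_big /=; apply: eq_bigr => i _.
  rewrite (reindex_inj (can_inj (@flipK _ i))); apply: eq_bigr => s _.
  by rewrite facet_flip flipK.
(* The part from the opposite face is re-indexed by flipping both [i] and [j]; the part from the
   neighbour by flipping [i] and exchanging the names [i] and [j]. *)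
have -> : \sum_s \sum_i \sum_j vtx s i j * (tri s *
         corner_share (size_of (flip i s)) (size_of (flip j s)) (size_of (flip i (flip j s)))) =
    \sum_s \sum_i \sum_j vtx s i j *
      (tri (flip i (flip j s)) * (~~ tri s * opp_share (size_of (flip i s)) (size_of s))
       + tri (flip j s) * (~~ tri (flip i s) * (share (size_of s) %/ 3))).
  under eq_bigr => s _ do
    (under eq_bigr => i _ do
       (under eq_bigr => j _ do rewrite /corner_share !mulnDr; rewrite big_split); rewrite big_split).
  under [RHS]eq_bigr => s _ do
    (under eq_bigr => i _ do
       (under eq_bigr => j _ do rewrite mulnDr; rewrite big_split); rewrite big_split).
  rewrite big_split [RHS]big_split /=; congr (_ + _).
    rewrite exchange_big [RHS]exchange_big /=; apply: eq_bigr => i _.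
    rewrite exchange_big [RHS]exchange_big /=; apply: eq_bigr => j _.
    rewrite (reindex_inj (can_inj (@flipK _ i))) (reindex_inj (can_inj (@flipK _ j))) /=.
    apply: eq_bigr => s _; rewrite vtx_flipl vtx_flipr.
    by rewrite (flipC j i (flip j s)) !flipK.
  rewrite exchange_big [RHS]exchange_big /=.
  under eq_bigr => i _ do rewrite exchange_big.
  under [RHS]eq_bigr => i _ do rewrite exchange_big.
  rewrite [RHS]exchange_big /=; apply: eq_bigr => i _; apply: eq_bigr => j _.
  rewrite (reindex_inj (can_inj (@flipK _ i))); apply: eq_bigr => s _.
  by rewrite vtx_flipl flipK (flipC j i) flipK (vtx_sym P_swap s j i).
rewrite -big_split [leqRHS]big_mkcond /=; apply: leq_sum => s _.
rewrite -big_split /=.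
eapply leq_trans; first by apply: leq_sum => i _; exact: edge_budget.
rewrite -big_distrl -size_of_sum /=.
case: ifP => [/regions_vtx[i [j]]/(size_of_ge3 P_swap P_second)/mul_share //|/negbT sR].
by rewrite (size_of_out sR).
Qed.

(** Discharging makes the average size at least 4, whereas with [n] lines the sizes sum to at most 4
    n (n - 1) over at least 2 + n (n - 1) regions. *)
Lemma heavy_absurd : False.
Proof.
have eq1 : \sum_s tri s * 180 = \sum_(s in regions P) tri s * 180.
  rewrite [RHS]big_mkcond; apply: eq_bigr => s _.
  by case: ifP => // /negbT/size_of_out ->.
have := discharging; rewrite eq1 => /charge_balance H.
have := sum_size_le P_rot P_second card_I; have := card_regions_ge P card_I.
have: 4 * #|regions P| <= \sum_(s in regions P) size_of s.
  by apply: H => s /regions_vtx[i [j]]; apply: size_of_ge3.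
by move: (\sum_(s in _) _) (#|I| * _) => m n; lia.
Qed.

End Discharging.

Lemma light_vertex (I : finType) (P : I -> I -> I -> bool) :
  (forall i j k, uniq [:: i; j; k] -> P j i k = ~~ P i j k) ->
  (forall i j k, uniq [:: i; j; k] -> P i k j = ~~ P i j k) ->
  (forall s i j, vtx P s i j -> exists2 k, k != j & vtx P s i k) ->
  5 <= #|I| ->
  exists s i j, vtx P s i j /\
    size_of P s + size_of P (flip i s) + size_of P (flip j s)
    + size_of P (flip i (flip j s)) <= 17.
Proof.
move=> P_swap P_rot P_second card_I.
pose light (p : {ffun I -> bool} * I * I) := let: (s, i, j) := p in
  vtx P s i j && (size_of P s + size_of P (flip i s) + size_of P (flip j s)
    + size_of P (flip i (flip j s)) <= 17).
have [/existsP[[[s i] j] /andP[h le]]|/existsPn heavy] := boolP [exists p, light p].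
  by exists s, i, j.
exfalso; apply: (heavy_absurd P_swap P_rot P_second card_I) => s i j h.
by move: (heavy (s, i, j)); rewrite /light h -ltnNge.
Qed.

(** * The merged face *)

Section MergedFace.

Variables (I : finType) (P : I -> I -> I -> bool).
Implicit Types (s t : {ffun I -> bool}) (i j k l : I).

Hypothesis P_swap : forall i j k, uniq [:: i; j; k] -> P j i k = ~~ P i j k.
Hypothesis P_rot : forall i j k, uniq [:: i; j; k] -> P i k j = ~~ P i j k.
Hypothesis P_second : forall s i j, vtx P s i j -> exists2 k, k != j & vtx P s i k.

Local Notation vtx := (vtx P).
Local Notation size_of := (size_of P).

Definition away s i j : {set I * I} :=
  [set p | [&& vtx s p.1 p.2, p.1 \notin [:: i; j] & p.2 \notin [:: i; j]]].

(** Three corners are lost, each in two orders: the vertex [i], [j] and the far ends of the sides on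
    [i] and [j]. They are distinct even in a triangle. *)
Lemma card_away s i j : vtx s i j -> #|away s i j| + 6 <= 2 * size_of s.
Proof.
move=> h; have [j' j'j hij'] := P_second h.
have hji : vtx s j i by rewrite vtx_sym.
have [i' i'i hji'] := P_second hji.
pose E := [:: (i, j); (j, i); (i, j'); (j', i); (j, i'); (i', j)].
have ij := vtx_neq h; have ij' := vtx_neq hij'; have ji' := vtx_neq hji'.
have uE : uniq E.
  rewrite /= !inE !xpair_eqE !negb_or !eqxx /=.
  move: ij ij' ji' j'j i'i; rewrite !andbT ?andTb => ij ij' ji' j'j i'i.
  rewrite ![i == _]eq_sym ![j == _]eq_sym in ij ij' ji' *.
  rewrite (eq_sym _ i') (eq_sym _ j').
  by rewrite ?(negbTE ij) ?(negbTE ij') ?(negbTE ji') ?(negbTE j'j) ?(negbTE i'i) ?andbF.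
have vE p : p \in E -> vtx s p.1 p.2.
  rewrite !inE => /orP[/eqP->//|/orP[/eqP->//|/orP[/eqP->//|/orP[/eqP->|/orP[/eqP->//|/eqP->]]]]] /=;
  by rewrite vtx_sym.
have -> : 2 * size_of s = #|[set p : I * I | vtx s p.1 p.2]|.
  rewrite mul2n -(sum_ends P_rot P_second) pair_big -sum1_card [RHS]big_mkcond /=.
  by apply: eq_bigr => p _; rewrite inE; case: (vtx s p.1 p.2).
have <- : #|[set p in E]| = 6 by rewrite cardsE; move/card_uniqP: uE => ->.
have dis : [disjoint away s i j & [set p in E]].
  rewrite -setI_eq0 -subset0; apply/subsetP=> -[x y].
  rewrite !inE !xpair_eqE /= !negb_or => /andP[/and3P[_ /andP[xi xj] /andP[yi yj]]].
  by rewrite (negbTE xi) (negbTE xj) (negbTE yi) (negbTE yj) !andbF.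
have [_ ] := leq_card_setU (away s i j) [set p in E]; rewrite dis => /eqP <-.
apply/subset_leq_card/subsetP=> p; rewrite in_setU [_ \in [set p | vtx _ _ _]]inE.
case/orP; first by rewrite inE => /and3P[].
by rewrite inE; apply: vE.
Qed.

(** The set [Q] is arbitrary, so the topological face only has to supply one of the four regions for
    each of its vertices. The 24 is four times the 6 of [card_away]. *)
Lemma card_merged_face s i j (Q : {set I * I}) : vtx s i j ->
  (forall p, p \in Q -> [/\ p.1 \notin [:: i; j], p.2 \notin [:: i; j] &
     exists2 t : {ffun I -> bool}, (forall k, k \notin [:: i; j] -> t k = s k) & vtx t p.1 p.2]) ->
  #|Q| + 24 <= 2 * (size_of s + size_of (flip i s) + size_of (flip j s)
                    + size_of (flip i (flip j s))).
Proof.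
move=> h hQ.
have c1 := card_away h.
have c2 : #|away (flip i s) i j| + 6 <= 2 * size_of (flip i s).
  by apply: card_away; rewrite vtx_flipl.
have c3 : #|away (flip j s) i j| + 6 <= 2 * size_of (flip j s).
  by apply: card_away; rewrite vtx_flipr.
have c4 : #|away (flip i (flip j s)) i j| + 6 <= 2 * size_of (flip i (flip j s)).
  by apply: card_away; rewrite vtx_flipl vtx_flipr.
have ij := vtx_neq h.
have sub : Q \subset away s i j :|: away (flip i s) i j
     :|: (away (flip j s) i j :|: away (flip i (flip j s)) i j).
  apply/subsetP=> p /hQ[n1 n2 [t ht hv]].
  have ext t' : t' i = t i -> t' j = t j -> (forall k, k \notin [:: i; j] -> t' k = s k) ->
      p \in away t' i j.
    move=> ei ej ek; suff <- : t = t' by rewrite inE hv n1 n2.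
    apply/ffunP=> k; have [->//|ki] := eqVneq k i; have [->//|kj] := eqVneq k j.
    by rewrite ht ?ek // !inE negb_or ki kj.
  have off (x y : bool) k : k \notin [:: i; j] ->
      s k (+) (x && (k == i)) (+) (y && (k == j)) = s k.
    by rewrite !inE negb_or => /andP[/negbTE-> /negbTE->]; rewrite !andbF !addbF.
  rewrite !in_setU; case ei: (t i == s i); case ej: (t j == s j).
  - by rewrite (ext s) //; apply/esym/eqP; rewrite ?ei ?ej.
  - rewrite (ext (flip j s)) ?orbT //; rewrite ?flipE.
    + by rewrite (negbTE ij) addbF (eqP ei).
    + by move: ej; rewrite eqxx addbT; case: (t j) (s j) => [] [].
    + by move=> k kn; rewrite flipE -[RHS](off false true k kn) /= addbF.
  - rewrite (ext (flip i s)) ?orbT //; rewrite ?flipE.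
    + by move: ei; rewrite eqxx addbT; case: (t i) (s i) => [] [].
    + by rewrite eq_sym (negbTE ij) addbF (eqP ej).
    + by move=> k kn; rewrite flipE -[RHS](off true false k kn) /= addbF.
  - rewrite (ext (flip i (flip j s))) ?orbT //; rewrite ?flipE.
    + by move: ei; rewrite (negbTE ij) eqxx addbF addbT; case: (t i) (s i) => [] [].
    + by move: ej; rewrite (eq_sym j i) (negbTE ij) eqxx addbF addbT; case: (t j) (s j) => [] [].
    + by move=> k kn; rewrite !flipE -[RHS](off true true k kn) /= addbAC.
move/subset_leq_card: sub.
have := leq_card_setU (away s i j) (away (flip i s) i j).
have := leq_card_setU (away (flip j s) i j) (away (flip i (flip j s)) i j).
have := leq_card_setU (away s i j :|: away (flip i s) i j)
  (away (flip j s) i j :|: away (flip i (flip j s)) i j).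
move=> [u1 _] [u2 _] [u3 _] u4; clear - c1 c2 c3 c4 u1 u2 u3 u4.
lia.
Qed.

End MergedFace.

(** * The chirotope of a line arrangement *)

Require Import Defs.
From mathcomp Require Import all_boot all_order all_algebra.
From mathcomp Require Import ring zify.
From mathcomp Require Import all_classical all_reals all_analysis.
Import Order.TTheory GRing.Theory Num.Theory.
Import numFieldTopology.Exports numFieldNormedType.Exports.
Local Open Scope classical_set_scope.
Local Open Scope ring_scope.

Section Cross.

Variable R : realType.
Implicit Types u v w x : 'rV[R]_3.

Let i0 : 'I_3 := ord0.
Let i1 : 'I_3 := lift ord0 ord0.
Let i2 : 'I_3 := lift ord0 (lift ord0 ord0).

Definition cross u v : 'rV[R]_3 :=
  \row_k [:: u 0 i1 * v 0 i2 - u 0 i2 * v 0 i1;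
             u 0 i2 * v 0 i0 - u 0 i0 * v 0 i2;
             u 0 i0 * v 0 i1 - u 0 i1 * v 0 i0]`_k.

Lemma dot3 u v : dot u v = u 0 i0 * v 0 i0 + u 0 i1 * v 0 i1 + u 0 i2 * v 0 i2.
Proof. by rewrite /dot !big_ord_recl big_ord0 addr0 addrA. Qed.

Lemma row3P u v :
  u 0 i0 = v 0 i0 -> u 0 i1 = v 0 i1 -> u 0 i2 = v 0 i2 -> u = v.
Proof.
move=> e0 e1 e2; apply/rowP=> k.
have [->|->|->] : [\/ k = i0, k = i1 | k = i2] by
  case: k => -[|[|[|//]]] p; [constructor 1|constructor 2|constructor 3]; apply/val_inj.
all: by [].
Qed.

Lemma cross0 u v : cross u v 0 i0 = u 0 i1 * v 0 i2 - u 0 i2 * v 0 i1.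
Proof. by rewrite mxE. Qed.
Lemma cross1 u v : cross u v 0 i1 = u 0 i2 * v 0 i0 - u 0 i0 * v 0 i2.
Proof. by rewrite mxE. Qed.
Lemma cross2 u v : cross u v 0 i2 = u 0 i0 * v 0 i1 - u 0 i1 * v 0 i0.
Proof. by rewrite mxE. Qed.

Let crossE := (cross0, cross1, cross2, dot3).

Lemma dotZr c u v : dot u (c *: v) = c * dot u v.
Proof. by rewrite !dot3 !mxE; ring. Qed.

Lemma dotNr u v : dot u (- v) = - dot u v.
Proof. by rewrite -scaleN1r dotZr mulN1r. Qed.

Lemma dot_cross_swap u v w : dot w (cross v u) = - dot w (cross u v).
Proof. by rewrite !crossE; ring. Qed.

Lemma dot_cross_rot u v w : dot v (cross u w) = - dot w (cross u v).
Proof. by rewrite !crossE; ring. Qed.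

Lemma dot_crossl u v : dot u (cross u v) = 0.
Proof. by rewrite !crossE; ring. Qed.

Lemma dot_crossr u v : dot v (cross u v) = 0.
Proof. by rewrite !crossE; ring. Qed.

Lemma cross_cross u v w : cross (cross u v) w = dot u w *: v - dot v w *: u.
Proof. by apply: row3P; rewrite ?crossE !mxE /= -!/i0 -!/i1 -!/i2 ?crossE; ring. Qed.

Lemma dot_gt0 u : u != 0 -> 0 < dot u u.
Proof.
move=> u0; rewrite lt0r; apply/andP; split; last first.
  by rewrite dot3 !addr_ge0 // -expr2 sqr_ge0.
apply: contra u0; rewrite dot3 !paddr_eq0 ?addr_ge0 -?expr2 ?sqr_ge0 //.
rewrite !sqrf_eq0 => /andP[/andP[/eqP e0 /eqP e1] /eqP e2].
by apply/eqP/row3P; rewrite mxE.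
Qed.

(** With q the cross product of [u] and [v], the triple product formula gives q × x = 0; applied
    again to (q × x) × q it yields x. *)
Lemma parallel_cross u v x : cross u v != 0 -> dot u x = 0 -> dot v x = 0 ->
  x = (dot (cross u v) x / dot (cross u v) (cross u v)) *: cross u v.
Proof.
set q := cross u v => q0 ux vx.
have qq := dot_gt0 q0.
have : cross (cross q x) q = 0.
  have -> : cross q x = 0 by rewrite cross_cross ux vx !scale0r subr0.
  by apply: row3P; rewrite !crossE !mxE; ring.
rewrite cross_cross => /eqP; rewrite subr_eq0 => /eqP E.
rewrite mulrC -scalerA -(_ : dot x q = dot q x); last by rewrite !dot3; ring.
by rewrite -E scalerA mulVf ?scale1r ?gt_eqF.
Qed.

(** Divided by both determinants on the left, this gives the difference of the parameters of [c] and
    [d] along line [a]. *)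
Lemma grassmann_plucker a b c d :
  dot (cross a b) (cross a c) * dot d (cross a b)
  - dot (cross a b) (cross a d) * dot c (cross a b)
  = dot (cross a b) (cross a b) * dot d (cross a c).
Proof. by rewrite !crossE; ring. Qed.

End Cross.

Lemma gt0_mul (R : realFieldType) (x y : R) :
  x != 0 -> y != 0 -> (0 < x * y) = ~~ ((0 < x) (+) (0 < y)).
Proof.
move=> x0 y0; case: (ltgtP 0 x) x0 => // hx _.
  by rewrite pmulr_rgt0 //=; case: (0 < y).
by rewrite nmulr_rgt0 // ltNge le_eqVlt eq_sym (negbTE y0).
Qed.

Lemma gt0_opp (R : realFieldType) (x : R) : x != 0 -> (0 < - x) = ~~ (0 < x).
Proof. by move=> x0; rewrite oppr_gt0 -leNgt le_eqVlt (negbTE x0). Qed.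

Section Chirotope.

Variables (R : realType) (n : nat) (a : 'I_n -> 'rV[R]_3).
Hypothesis gen : general_position a.

(** The determinant of three normals, read as the value on line [k] of the representative
    [cross (a i) (a j)] of a vertex. *)
Definition chi (i j k : 'I_n) : R := dot (a k) (cross (a i) (a j)).
Definition chi_pos (i j k : 'I_n) : bool := 0 < chi i j k.

(** If the product vanished, [dot (a i) x *: a j = dot (a j) x *: a i] for all [x], and the two
    lines would coincide. *)
Lemma cross_neq0 i j : i != j -> cross (a i) (a j) != 0.
Proof.
move=> ij; apply/eqP=> q0; case: gen => a0 /(_ i j ij) + _; apply => x.
have E : dot (a i) x *: a j = dot (a j) x *: a i.
  apply/eqP; rewrite -subr_eq0 -cross_cross q0.
  by apply/eqP/rowP=> k; rewrite !mxE; case: k => -[|[|[|//]]] p /=; rewrite !mul0r subr0.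
split=> -[x0 h]; split=> //; move: E; rewrite h scale0r => /esym/eqP.
  by rewrite scaler_eq0 (negbTE (a0 i)) orbF => /eqP.
by rewrite eq_sym scaler_eq0 (negbTE (a0 j)) orbF => /eqP.
Qed.

Lemma uniq3P (T : eqType) (i j k : T) : uniq [:: i; j; k] -> [/\ i != j, j != k & i != k].
Proof. by rewrite /= !inE negb_or andbT => /andP[/andP[-> ->] ->]. Qed.

Lemma chi_neq0 i j k : uniq [:: i; j; k] -> chi i j k != 0.
Proof.
case/uniq3P=> ij jk ik; apply/eqP=> h; case: gen => _ _ /(_ i j k ij jk ik); apply.
exists (cross (a i) (a j)); have q0 := cross_neq0 ij.
by split; split=> //; rewrite ?dot_crossl ?dot_crossr.
Qed.

Lemma chi_pos_swap i j k : uniq [:: i; j; k] -> chi_pos j i k = ~~ chi_pos i j k.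
Proof. by move=> u; rewrite /chi_pos {1}/chi dot_cross_swap gt0_opp ?chi_neq0. Qed.

Lemma chi_pos_rot i j k : uniq [:: i; j; k] -> chi_pos i k j = ~~ chi_pos i j k.
Proof. by move=> u; rewrite /chi_pos {1}/chi dot_cross_rot gt0_opp ?chi_neq0. Qed.

End Chirotope.

Section SecondEnd.

Variables (R : realType) (n : nat) (a : 'I_n -> 'rV[R]_3).
Hypothesis gen : general_position a.
Hypothesis n5 : (5 <= #|'I_n|)%N.

(* Along line [i] the other lines cross in the order of the real parameter
   [dot q (cross a_i a_k) / chi i j k], where [q] is the vertex [i, j]. *)
Lemma second_end (s : {ffun 'I_n -> bool}) i j : vtx (chi_pos a) s i j ->
  exists2 k, k != j & vtx (chi_pos a) s i k.
Proof.
case/vtxP=> ij [e he].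
pose q := cross (a i) (a j).
(* In this parameter the vertex [i], [j] is at infinity; [b] orients it so that the edge leaving
   that vertex first meets the line maximising [f]. *)
pose b := s j (+) e.
pose f k := (-1) ^+ b * (dot q (cross (a i) (a k)) / chi a i j k).
have [k0] := pick_other n5 (s := [:: i; j]) isT.
rewrite !seq.inE negb_or => Pk0.
case: (@arg_maxP _ _ _ k0 (fun k => (k != i) && (k != j)) f Pk0) => k /andP[ki kj] kmax.
have u3 x y z : x != y -> y != z -> x != z -> uniq [:: x; y; z].
  by move=> xy yz xz; rewrite /= !inE negb_or xy xz yz.
exists k => //; apply/vtxP; split; first by rewrite eq_sym.
(* The antipode is dictated by the sign on [j]. *)
exists (s j (+) ~~ chi_pos a i j k) => l li lk.
have uijk : uniq [:: i; j; k] by apply: u3; rewrite // eq_sym.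
have [->|lj] := eqVneq l j.
  by rewrite (chi_pos_rot gen uijk) -addbA addbb addbF.
have uijl : uniq [:: i; j; l] by apply: u3; rewrite // eq_sym.
have uikl : uniq [:: i; k; l] by apply: u3; rewrite // eq_sym.
have [nk nl nkl] := And3 (chi_neq0 gen uijk) (chi_neq0 gen uijl) (chi_neq0 gen uikl).
have qq : 0 < dot q q by apply/dot_gt0/(cross_neq0 gen).
have E : f k - f l = (-1) ^+ b * (dot q q * (chi a i k l * (chi a i j k * chi a i j l)^-1)).
  rewrite -mulrBr; congr (_ * _).
  have := grassmann_plucker (a i) (a j) (a k) (a l).
  rewrite -/q -![dot _ q]/(chi a i j _) -[dot (a l) (cross _ _)]/(chi a i k l) => gp.
  by rewrite mulrA -gp; field; rewrite nk nl.
have : 0 <= f k - f l by rewrite subr_ge0; apply: kmax; rewrite li lj.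
have pn0 : chi a i k l * (chi a i j k * chi a i j l)^-1 != 0.
  by rewrite mulf_neq0 // invr_neq0 // mulf_neq0.
rewrite he // le_eqVlt eq_sym E.
have qn0 : dot q q * (chi a i k l * (chi a i j k * chi a i j l)^-1) != 0.
  by rewrite mulf_neq0 // gt_eqF.
rewrite (negbTE (mulf_neq0 _ qn0)) ?signr_eq0 //=.
have -> : (0 < (-1) ^+ b * (dot q q * (chi a i k l * (chi a i j k * chi a i j l)^-1))) =
    b (+) (0 < chi a i k l * (chi a i j k * chi a i j l)^-1).
  case: (b); rewrite /= ?expr0 ?expr1 ?mul1r ?mulN1r ?gt0_opp // pmulr_rgt0 //.
rewrite gt0_mul ?invr_neq0 ?mulf_neq0 // invr_gt0 gt0_mul // /b.
rewrite -!/(chi_pos a _ _ _).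
by case: (s j) e {he b f E kmax} (chi_pos a i j k) (chi_pos a i j l) (chi_pos a i k l)
  => [] [] [] [] [].
Qed.

End SecondEnd.

Lemma dotC (R : realType) (u v : 'rV[R]_3) : dot u v = dot v u.
Proof. by rewrite !dot3; ring. Qed.

(** * Signs on closed faces *)

Section Faces.

Variables (R : realType) (n : nat) (a : 'I_n -> 'rV[R]_3).

Lemma continuous_dot (u : 'rV[R]_3) : continuous (dot u).
Proof.
have -> : dot u = fun v => u 0 ord0 * v 0 ord0 + u 0 (lift ord0 ord0) * v 0 (lift ord0 ord0)
    + u 0 (lift ord0 (lift ord0 ord0)) * v 0 (lift ord0 (lift ord0 ord0)).
  by apply/funext => v; rewrite dot3.
have c k : continuous (fun v : 'rV[R]_3 => u 0 k * v 0 k).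
  move=> x; apply: (@continuousM R 'rV[R]_3 (fun=> u 0 k) (fun v => v 0 k)).
    exact: cst_continuous.
  exact: coord_continuous.
move=> x; apply: (@continuousD R R^o 'rV[R]_3 (fun v => _ + _) (fun v => _)); last exact: c.
by apply: (@continuousD R R^o 'rV[R]_3 (fun v => u 0 ord0 * v 0 ord0) (fun v => _)); apply: c.
Qed.

(** The image of a connected set under [dot (a k)] is an interval; a change of sign would put 0 in
    it. *)
Lemma component_side (P : 'I_n -> bool) (v x : 'rV[R]_3) k : P k ->
  connected_component (arr_complement a P) v x -> 0 <= dot (a k) v * dot (a k) x.
Proof.
move=> Pk [B [Bv BA Bc] Bx].
have cont : {within B, continuous (dot (a k))}.
  by apply: continuous_subspaceT => y; apply: continuous_dot.
have /connected_intervalP itv := connected_continuous_connected Bc cont.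
rewrite leNgt; apply/negP=> neg.
have [y By y0] : (dot (a k) @` B) 0.
  case: (ltgtP (dot (a k) v) 0) => [v0|v0|v0].
  - apply: (itv (dot (a k) v) (dot (a k) x)); [by exists v|by exists x|].
    by rewrite ltW //= ltW // -(nmulr_rlt0 _ v0).
  - apply: (itv (dot (a k) x) (dot (a k) v)); [by exists x|by exists v|].
    by rewrite ltW ?(ltW v0) //= -(pmulr_rlt0 _ v0).
  - by exists v.
by have [_ /(_ k Pk)] := BA y By; rewrite y0 eqxx.
Qed.

(** The face cone lies in the union of two closed cones, one for [v] and one for [- v], which
    therefore contains its closure. *)
Lemma closure_face_side (P : 'I_n -> bool) (v w : 'rV[R]_3) :
  closure (face_cone a P v) w ->
  exists e : bool, forall k, P k -> 0 <= dot (a k) v * dot (a k) ((-1) ^+ e *: w).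
Proof.
pose C (e : bool) := [set x | forall k, P k -> 0 <= dot (a k) v * dot (a k) ((-1) ^+ e *: x)].
have clC e : closed (C e).
  have -> : C e = \bigcap_(k in [set k | P k])
      (dot ((dot (a k) v * (-1) ^+ e) *: a k) @^-1` [set y | 0 <= y]).
    have dE k x : dot ((dot (a k) v * (-1) ^+ e) *: a k) x =
        dot (a k) v * dot (a k) ((-1) ^+ e *: x) by rewrite dotC !dotZr (dotC x) mulrA.
    by apply/seteqP; split=> x h k /h; rewrite /= dE.
  apply: closed_bigI => k _; apply: closed_comp; last exact: closed_ge.
  by move=> x _; apply: continuous_dot.
have sub : face_cone a P v `<=` C false `|` C true.
  move=> x [h|h]; [left|right] => k Pk; have := component_side Pk h.
    by rewrite expr0 scale1r.
  by rewrite dotNr expr1 scaleN1r dotNr mulNr mulrN.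
have /closure_id clU : closed (C false `|` C true) by apply: closedU.
by move=> /(closureS sub); rewrite -clU => -[h|h]; [exists false|exists true].
Qed.

End Faces.

(** * The zone of a vertex *)

Section Zone.

Variables (R : realType) (n : nat) (a : 'I_n -> 'rV[R]_3).
Hypothesis gen : general_position a.

Local Notation others i j := (fun k : 'I_n => (k != i) && (k != j)).

Definition zone_vertices (i j : 'I_n) (v : 'rV[R]_3) : {set 'I_n * 'I_n} :=
  finset (fun p : 'I_n * 'I_n => [&& (p.1 < p.2)%N, others i j p.1, others i j p.2 &
                    `[< vertex_on_face a (others i j) v p.1 p.2 >]]).

Lemma zone_complexityE i j v : zone_complexity a i j v = #|zone_vertices i j v|.
Proof.
rewrite /zone_complexity /face_size; apply: eq_card => p.
by rewrite finset.inE; apply/idP/idP; rewrite inE.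
Qed.

(** This crude bound settles arrangements of at most four lines. *)
Lemma zone_complexity_le_sqr i j v :
  i != j -> (zone_complexity a i j v <= (n - 2) ^ 2)%N.
Proof.
move=> ij; rewrite zone_complexityE.
have <- : #|(~: [set i; j])%SET| = (n - 2)%N.
  by rewrite cardsCs finset.setCK cards2 ij card_ord.
rewrite -mulnn -cardsX; apply: subset_leq_card; apply/fintype.subsetP=> -[k l].
by rewrite !finset.inE !negb_or => /and4P[_ -> ->].
Qed.

(* The vertex [k, l] on the zone of [v] lies on one of the regions around [v]:
   the one found by reading off the signs of that vertex on lines [i] and [j]. *)
Lemma zone_vertex_region (s : {ffun 'I_n -> bool}) (i j k l : 'I_n) v :
  (forall m, others i j m -> dot (a m) v != 0) ->
  (forall m, others i j m -> s m = (0 < dot (a m) v)) ->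
  others i j k -> others i j l -> k != l -> vertex_on_face a (others i j) v k l ->
  exists2 t : {ffun 'I_n -> bool},
    (forall m, m \notin [:: i; j] -> t m = s m) & vtx (chi_pos a) t k l.
Proof.
move=> v0 sv ok ol kl [w [[w0 wk] [_ wl] /closure_face_side[e side]]].
pose w' := (-1) ^+ e *: w.
have w'0 : w' != 0 by rewrite scaler_eq0 signr_eq0.
have [w'k w'l] : dot (a k) w' = 0 /\ dot (a l) w' = 0 by rewrite !dotZr wk wl mulr0.
have := parallel_cross (cross_neq0 gen kl) w'k w'l.
set c := (_ / _) => w'E.
have c0 : c != 0 by apply: contra_neq w'0 => c0; rewrite w'E c0 scale0r.
have dE m : dot (a m) w' = c * chi a k l m by rewrite w'E dotZr.
pose t : {ffun 'I_n -> bool} := [ffun m => if m \in [:: i; j] then 0 < dot (a m) w' else s m].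
exists t; first by move=> m /negbTE mij; rewrite ffunE mij.
apply/vtxP; split=> //; exists (~~ (0 < c)) => m mk ml.
have x0 : chi a k l m != 0 by apply: chi_neq0; rewrite //= !seq.inE negb_or kl ![_ == m]eq_sym mk ml.
(* The closure gives only weak inequalities; general position makes them strict. *)
have tm : t m = (0 < dot (a m) w').
  rewrite ffunE; case: ifPn => //; rewrite !seq.inE negb_or => om.
  have d0 : dot (a m) w' != 0 by rewrite dE mulf_neq0.
  have := side m om; rewrite -/w' le_eqVlt eq_sym (negbTE (mulf_neq0 (v0 m om) d0)) /=.
  by rewrite gt0_mul ?v0 // sv //; case: (0 < dot _ v) (0 < dot _ w') => [] [].
by rewrite tm dE gt0_mul // /chi_pos; case: (0 < c) (0 < chi _ _ _ _) => [] [].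
Qed.

End Zone.

Theorem theorem1 (R : realType) (n : nat) (a : 'I_n -> 'rV[R]_3) :
  (2 <= n)%N -> general_position a ->
  exists i j : 'I_n, exists v : 'rV[R]_3,
    [/\ i != j, on_line (a i) v, on_line (a j) v & (zone_complexity a i j v <= 5)%N].
Proof.
move=> n2 gen; have [n5|n5] := leqP 5 n; last first.
  pose i : 'I_n := Ordinal (ltnW n2); pose j : 'I_n := Ordinal n2.
  have ij : i != j by [].
  exists i, j, (cross (a i) (a j)); have q0 := cross_neq0 gen ij.
  split=> //; [by rewrite /on_line dot_crossl|by rewrite /on_line dot_crossr|].
  apply: leq_trans (zone_complexity_le_sqr _ _ ij) _.
  by case: n n2 n5 {a gen i j ij q0} => [|[|[|[|[|]]]]].
have n5' : (5 <= #|'I_n|)%N by rewrite card_ord.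
have sw := chi_pos_swap gen; have rot := chi_pos_rot gen; have second := second_end gen n5'.
have [s [i [j [h le17]]]] := light_vertex sw rot second n5'.
case/vtxP: (h) => ij [e se].
(* The antipode whose signs off [i] and [j] are those of [s]. *)
pose v := (-1) ^+ e *: cross (a i) (a j).
have q0 := cross_neq0 gen ij.
have v0 : v != 0 by rewrite scaler_eq0 signr_eq0.
have dE m : dot (a m) v = (-1) ^+ e * chi a i j m by rewrite dotZr.
exists i, j, v; split=> //.
- by split=> //; rewrite dotZr dot_crossl mulr0.
- by split=> //; rewrite dotZr dot_crossr mulr0.
have chi0 m : (m != i) && (m != j) -> chi a i j m != 0.
  by case/andP=> mi mj; apply: (chi_neq0 gen); rewrite /= !seq.inE negb_or ij ![_ == m]eq_sym mi mj.
have vm m : (m != i) && (m != j) -> dot (a m) v != 0.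
  by move=> om; rewrite dE mulf_neq0 ?signr_eq0 ?chi0.
have sv m : (m != i) && (m != j) -> s m = (0 < dot (a m) v).
  move=> om; case/andP: (om) => mi mj; rewrite se // dE /chi_pos.
  by case: (e); rewrite ?expr0 ?expr1 ?mul1r ?mulN1r ?gt0_opp ?chi0.
rewrite zone_complexityE; set F := zone_vertices _ _ _ _.
pose swp (p : 'I_n * 'I_n) := (p.2, p.1).
have swpK : involutive swp by case.
(* [F] holds increasing pairs, while the corners of regions were counted as ordered pairs. *)
pose Q := (F :|: swp @: F)%SET.
have cQ : #|Q| = (2 * #|F|)%N.
  have dis : (F :&: swp @: F = finset.set0)%SET.
    apply/eqP; rewrite -finset.subset0; apply/fintype.subsetP=> -[x y].
    rewrite !finset.inE /= => /andP[/andP[xy _] /imsetP[[x' y']]].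
    rewrite finset.inE /= => /andP[xy' _] [ex ey].
    by move: xy xy'; rewrite ex ey ltnNge leq_eqVlt => /norP[_ /negbTE->].
  by rewrite cardsU dis cards0 subn0 card_imset ?mul2n ?addnn //; apply: can_inj swpK.
have FQ p : p \in F -> [/\ p.1 != p.2, p.1 \notin [:: i; j], p.2 \notin [:: i; j] &
     exists2 t : {ffun 'I_n -> bool}, (forall k, k \notin [:: i; j] -> t k = s k) &
       vtx (chi_pos a) t p.1 p.2].
  case: p => k l; rewrite finset.inE /= => /and4P[kl ok ol /asboolP hv].
  have nkl : k != l by rewrite neq_ltn kl.
  rewrite !seq.inE !negb_or; split=> //.
  exact: (zone_vertex_region gen vm sv ok ol nkl hv).
have := @card_merged_face _ _ sw rot second s i j Q h.
(* Here 34 is twice 17, which leaves at most 5 vertices. *)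
rewrite cQ => H; have {H} : (2 * #|F| + 24 <= 34)%N.
  apply: leq_trans (H _) _; last exact: (leq_mul (leqnn 2) le17).
  move=> p; rewrite finset.in_setU => /orP[/FQ[]//|/imsetP[p' /FQ[_ n1 n2' [t ht hv]] ->]].
  by split=> //; exists t => //; rewrite (vtx_sym sw).
lia.
Qed.
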